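(* Let $G$ and $H$ be groups, let $(u,v) \in G \times H$, and let $(u,v)^{G \times H}$ be the normal closure of $(u,v)$ in $G \times H$. Then: 1. ${}^*E_1(G\times H, (u, v)) = R_1(G \times H, (u, v)) = C_{G\times H}((u, v))$; 2. $E_1^*(G \times H, (u, v)) = \bigcap_{(x, y) \in G \times H}R_1(G \times H, (u, v)^{(x, y)}) = C_{G\times H}((u, v)^{G\times H})$.
   Context: For elements $p,q$ of a group, the commutator is $[p,q] = p^{-1}q^{-1}pq$, and $p$ conjugated by $q$ is $p^{q} = q^{-1}pq$. Let $K = G \times H$ be the direct product group, with identity $(1,1)$, and let $k \in K$. The left centralizer-like subgroup associated with the 1-Engel word is ${}^*E_1(K,k) = \{a \in K \mid [ax,k] = [x,k] \text{ for all } x \in K\}$. The right centralizer-like subgroup associated with the 1-Engel word is $E_1^*(K,k) = \{a \in K \mid [xa,k] = [x,k] \text{ for all } x \in K\}$. The set of right 1-Engel elements of $K$ with the element $k$ is $R_1(K,k) = \{a \in K \mid [a,k] = (1,1)\}$. The centralizer of $k$ in $K$ is $C_K(k) = \{a \in K \mid [a,k] = (1,1)\}$. The normal closure $k^K$ of $k$ in $K$ is the smallest normal subgroup of $K$ containing $k$, and its centralizer is $C_K(k^K) = \{a \in K \mid [a,z] = (1,1) \text{ for all } z \in k^K\}$. *)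

(* Defs.v *)
From mathcomp Require Import all_boot.
From mathcomp Require Import boolp classical_sets.
Set Implicit Arguments.
Unset Strict Implicit.
Unset Printing Implicit Defensive.

Local Open Scope classical_set_scope.
Local Open Scope group_scope.

(* The library defines x ^ y as y^-1 * (x * y) and [~ x, y] as x^-1 * x ^ y,
   i.e. x^-1 y^-1 x y. A groupType may be infinite. *)

Definition left_E1 (K : groupType) (k : K) : set K :=
  [set a | forall x : K, [~ a * x, k] = [~ x, k]].

Definition right_E1 (K : groupType) (k : K) : set K :=
  [set a | forall x : K, [~ x * a, k] = [~ x, k]].

Definition right_1Engel (K : groupType) (k : K) : set K :=
  [set a | [~ a, k] = 1].

Definition centralizer1 (K : groupType) (k : K) : set K :=
  [set a | [~ a, k] = 1].

Definition centralizer (K : groupType) (S : set K) : set K :=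
  [set a | forall z : K, S z -> [~ a, z] = 1].

(* group_closed: contains 1 and is closed under x, y |-> x * y^-1. *)
Definition normal_subgroup (K : groupType) (N : set K) : Prop :=
  group_closed [in N] /\ (forall x g : K, N x -> N (x ^ g)).

Definition normal_closure (K : groupType) (k : K) : set K :=
  smallest (@normal_subgroup K) [set k].

Arguments left_E1 : clear implicits.
Arguments right_E1 : clear implicits.
Arguments right_1Engel : clear implicits.
Arguments centralizer1 : clear implicits.
Arguments centralizer : clear implicits.
Arguments normal_subgroup : clear implicits.
Arguments normal_closure : clear implicits.

(* Main.v *)
Require Import Defs.
From mathcomp Require Import all_boot.
From mathcomp Require Import boolp classical_sets.

Local Open Scope classical_set_scope.
Local Open Scope group_scope.

(** Write [ax, k] = x^-1 [a, k] x^k: cancelling x^-1 and x^k, this equals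
    [x, k] exactly when [a, k] = 1.  Write [xa, k] = (k^-1)^(xa) k: cancelling k,
    this equals [x, k] exactly when a fixes k^x under conjugation.  Finally, the
    elements all of whose conjugates commute with a form a normal subgroup, so
    if a commutes with every conjugate of k it centralizes the normal closure. *)

Lemma left_E1E (K : groupType) (k : K) : left_E1 K k = right_1Engel K k.
Proof.
apply/seteqP; split=> a /=.
  by move=> /(_ 1); rewrite mulg1 comm1g.
move=> ak x; rewrite !commgEl invgM conjMg -mulgA (mulgA a^-1).
by rewrite -(commgEl a) ak mul1g.
Qed.

Lemma right_E1E (K : groupType) (k : K) :
  right_E1 K k = \bigcap_(x : K) right_1Engel K (k ^ x).
Proof.
(* The equivalence holds for each [x] separately, so quantifying over [x] yields the
   intersection. *)
have E (a x : K) : [~ x * a, k] = [~ x, k] <-> [~ a, k ^ x] = 1.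
  rewrite !(commgEr _ k) conjgM !conjVg; split.
    by move=> /mulIg/invg_inj/conjg_fixP; rewrite commg1_sym => /eqP.
  by move=> /eqP; rewrite commg1_sym => /conjg_fixP ->.
by apply/seteqP; split=> a /= Ha x => [_|]; apply/E/Ha.
Qed.

(** [smallest] is an intersection, and each closure condition passes to it from every member [N]. *)
Lemma normal_closure_normal (K : groupType) (k : K) :
  normal_subgroup K (normal_closure K k).
Proof.
split; first split.
- by apply/mem_set => N [[[/set_mem N1 _] _] _].
- move=> x y /set_mem Nx /set_mem Ny; apply/mem_set => N NP.
  have [[[_ NV] _] _] := NP.
  by apply/set_mem/NV; apply/mem_set; [exact: (Nx N NP) | exact: (Ny N NP)].
- by move=> x g Nx N NP; have [[_ NJ] _] := NP; exact: NJ _ _ (Nx N NP).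
Qed.

(** Conjugation by [g] is a homomorphism and the centralizer of [a] is a subgroup; ranging over all
    [g] gives normality, as [(x ^ h) ^ g = x ^ (h * g)]. *)
Lemma commute_conj_normal (K : groupType) (a : K) :
  normal_subgroup K [set z | forall g : K, commute a (z ^ g)].
Proof.
split; first split.
- by apply/mem_set => g /=; rewrite conj1g; apply: commute1.
- move=> x y /set_mem /= ax /set_mem /= ay; apply/mem_set => g /=.
  by rewrite conjMg conjVg; apply/commuteM/commuteV.
- by move=> x h /= ax g; rewrite -conjgM.
Qed.

Lemma centralizer_normal_closure (K : groupType) (k : K) :
  \bigcap_(x : K) right_1Engel K (k ^ x) = centralizer K (normal_closure K k).
Proof.
apply/seteqP; split=> a /= Ha.
  (* Writing [z] as [z ^ 1] and generalizing [1] strengthens the goal to all conjugates of [z], so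
     that minimality of the closure applies. *)
  move=> z zN; apply/eqP/commgP; rewrite -(conjg1 z); move: z zN 1.
  apply: smallest_sub; first exact: commute_conj_normal.
  by move=> _ -> g; apply/commgP/eqP/Ha.
move=> x _; apply: Ha; apply: (normal_closure_normal K k).2.
exact: sub_gen_smallest.
Qed.

Theorem theorem5 (G H : groupType) (u : G) (v : H) :
  (left_E1 (G * H)%type (u, v) = right_1Engel (G * H)%type (u, v) /\
   right_1Engel (G * H)%type (u, v) = centralizer1 (G * H)%type (u, v)) /\
  (right_E1 (G * H)%type (u, v) =
     \bigcap_(xy : G * H) right_1Engel (G * H)%type ((u, v) ^ xy) /\
   \bigcap_(xy : G * H) right_1Engel (G * H)%type ((u, v) ^ xy) =
     centralizer (G * H)%type (normal_closure (G * H)%type (u, v))).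
Proof.
split; split.
- exact: left_E1E.
(* Both sides unfold to the same set. *)
- by [].
- exact: right_E1E.
- exact: centralizer_normal_closure.
Qed.
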